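(* Let $F$ be a field and $n\in\mathbb N\cup\{\infty\}$. Every almost identity PC-map $\varphi:\mathrm{UT}(n,F)\to\mathrm{UT}(n,F)$ is a central map, i.e. $\varphi(a)=af(a)$ for some function $f$ from $\mathrm{UT}(n,F)$ to its center $C$. In particular, for finite $n$ one has $\varphi(a)=a\,t_{1n}(f(a))$ for some function $f:\mathrm{UT}(n,F)\to F$, and for $n=\infty$, $\varphi$ is the identity.
   Context: $\mathrm{UT}(n,F)$ is the group of upper unitriangular $n\times n$ matrices over $F$ (for $n=\infty$: all $\mathbb N\times\mathbb N$ matrices with $1$ on the diagonal and $0$ below it). $e$ is the identity, $e_{ij}$ the matrix unit, $t_{ij}(\alpha)=e+\alpha e_{ij}$ ($i<j$). $[x,y]=xyx^{-1}y^{-1}$. A PC-map is a bijection $\varphi$ of the group with $\varphi([x,y])=[\varphi(x),\varphi(y)]$ for all $x,y$; it is almost identity if $\varphi(t_{ij}(\alpha))=t_{ij}(\alpha)$ for all $i<j$, $\alpha\in F$. The center $C$ of $\mathrm{UT}(n,F)$ is trivial if $n=\infty$ and is $\{t_{1n}(\alpha):\alpha\in F\}$ for finite $n$. *)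

(* Defs.v *)
From HB Require Import structures.
From mathcomp Require Import all_boot all_order all_algebra.
Set Implicit Arguments. Unset Strict Implicit. Unset Printing Implicit Defensive.
Import Order.TTheory GRing.Theory Num.Theory.
Local Open Scope ring_scope.

Definition commg_of (T : Type) (mul : T -> T -> T) (inv : T -> T) (x y : T) : T :=
  mul (mul (mul x y) (inv x)) (inv y).

Definition is_PC_map (T : Type) (G : T -> Prop) (mul : T -> T -> T) (inv : T -> T)
  (phi : T -> T) : Prop :=
  (forall x, G x -> G (phi x)) /\
  (forall x y, G x -> G y -> phi x = phi y -> x = y) /\
  (forall y, G y -> exists2 x, G x & phi x = y) /\
  (forall x y, G x -> G y ->
     phi (commg_of mul inv x y) = commg_of mul inv (phi x) (phi y)).

Definition is_UT (F : fieldType) (n : nat) (A : 'M[F]_n) : Prop :=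
  (forall i : 'I_n, A i i = 1) /\ (forall i j : 'I_n, (j < i)%N -> A i j = 0).

Definition tmx (F : fieldType) (n : nat) (i j : 'I_n) (alpha : F) : 'M[F]_n :=
  1%:M + alpha *: delta_mx i j.

(* t_{1n}(alpha) (0-indexed: entry (0, n-1)) ; meaningful for n >= 2 *)
Definition t1n (F : fieldType) (n : nat) (alpha : F) : 'M[F]_n :=
  \matrix_(i, j) (if i == j then 1
                  else if (val i == 0%N) && (val j == n.-1) then alpha else 0).

Definition comm_fin (F : fieldType) (n : nat) (x y : 'M[F]_n) : 'M[F]_n :=
  commg_of (@mulmx F n n n) (@invmx F n) x y.

Definition is_PC_fin (F : fieldType) (n : nat) (phi : 'M[F]_n -> 'M[F]_n) : Prop :=
  is_PC_map (@is_UT F n) (@mulmx F n n n) (@invmx F n) phi.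

Definition almost_id_fin (F : fieldType) (n : nat) (phi : 'M[F]_n -> 'M[F]_n) : Prop :=
  forall (i j : 'I_n) (alpha : F), (i < j)%N -> phi (tmx i j alpha) = tmx i j alpha.

Definition in_center_fin (F : fieldType) (n : nat) (z : 'M[F]_n) : Prop :=
  is_UT z /\ forall x, is_UT x -> z *m x = x *m z.

Definition imx (F : fieldType) := nat -> nat -> F.

Definition is_UTI (F : fieldType) (A : imx F) : Prop :=
  (forall i, A i i = 1) /\ (forall i j, (j < i)%N -> A i j = 0).

(* product; (AB)_ij = sum_{i<=k<=j} A_ik B_kj, which is the full
   product for upper triangular matrices (all other terms vanish) *)
Definition mulI (F : fieldType) (A B : imx F) : imx F :=
  fun i j => \sum_(i <= k < j.+1) A i k * B k j.

(* inverse of a unitriangular matrix: B_ii = 1,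
   B_ij = - sum_{i<=k<j} B_ik A_kj  (i<j), B_ij = 0 (j<i). *)
Fixpoint invrowI (F : fieldType) (A : imx F) (i d : nat) : seq F :=
  match d with
  | 0 => [:: 1]
  | d'.+1 => let s := invrowI A i d' in
             rcons s (- \sum_(k < d'.+1) s`_k * A (i + k)%N (i + d'.+1)%N)
  end.

Definition invI (F : fieldType) (A : imx F) : imx F :=
  fun i j => if (j < i)%N then 0 else (invrowI A i (j - i))`_(j - i).

Definition tI (F : fieldType) (i j : nat) (alpha : F) : imx F :=
  fun k l => (if k == l then 1 else 0) + (if (k == i) && (l == j) then alpha else 0).

Definition is_PC_inf (F : fieldType) (phi : imx F -> imx F) : Prop :=
  is_PC_map (@is_UTI F) (@mulI F) (@invI F) phi.

Definition almost_id_inf (F : fieldType) (phi : imx F -> imx F) : Prop :=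
  forall (i j : nat) (alpha : F), (i < j)%N -> phi (tI i j alpha) = tI i j alpha.

Definition in_center_inf (F : fieldType) (z : imx F) : Prop :=
  is_UTI z /\ forall x, is_UTI x -> mulI z x = mulI x z.

(* Main.v *)
Require Import Defs.
From Stdlib Require Import FunctionalExtensionality.
From HB Require Import structures.
From mathcomp Require Import all_boot all_order all_algebra ring zify.
Import GRing.Theory.
Local Open Scope ring_scope.

Set Implicit Arguments.
Unset Strict Implicit.

(** The hypothesis is used only in the form: [x y = z (y x)] implies
    [phi x * phi y = phi z * (phi y * phi x)].  The commutator of [a] with [t_in] is an element
    whose only nontrivial column is the last one and carries column [i] of [a]; so if such
    column elements are fixed by [phi], then [phi a] and [a] have the same columns except the
    last.  Column elements are shown to be fixed by induction on their support, writing each as a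
    commutator of two elements with smaller columns.  For finite [n], conjugating [phi] by the
    automorphism [x |-> (J x^T J)^-1] gives the same for the rows of the inverses except the
    first, so [a^-1 * phi a] is trivial outside its corner.  For [n = oo] every
    column of [a] is read off [[a, t_kl]], and there is no last column to except. *)

(** * Commutator equations free of inverses *)

Definition preserves_comm (T : Type) (G : T -> Prop) (mul : T -> T -> T) (phi : T -> T) :=
  (forall x, G x -> G (phi x)) /\
  forall x y z, G x -> G y -> G z ->
    mul x y = mul z (mul y x) -> mul (phi x) (phi y) = mul (phi z) (mul (phi y) (phi x)).

Lemma PC_map_preserves_comm (T : Type) (G : T -> Prop) (mul : T -> T -> T) (inv : T -> T)
    (one : T) (phi : T -> T) :
  associative mul -> (forall x y, G x -> G y -> G (mul x y)) ->
  (forall x, G x -> G (inv x)) -> (forall x, G x -> mul x one = x) ->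
  (forall x, G x -> mul x (inv x) = one) -> (forall x, G x -> mul (inv x) x = one) ->
  is_PC_map G mul inv phi -> preserves_comm G mul phi.
Proof.
move=> mulA mulG invG mul1 mulV mulVl [phiG [_ [_ phiC]]]; split=> // x y z Gx Gy Gz e.
have mulK u v : G u -> G v -> mul (mul u v) (inv v) = u.
  by move=> Gu Gv; rewrite -mulA mulV // mul1.
have mulVK u v : G u -> G v -> mul (mul u (inv v)) v = u.
  by move=> Gu Gv; rewrite -mulA mulVl // mul1.
(* Rewriting [x y] as [z (y x)] collapses the commutator of [x] and [y] to [z], so [phi z] is the
   commutator of the images. *)
have := phiC x y Gx Gy; rewrite {1}/commg_of e mulA !mulK //; last exact: mulG.
move=> ->; rewrite /commg_of mulA.
have Gpx := phiG _ Gx; have Gpy := phiG _ Gy.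
by rewrite !mulVK; auto.
Qed.

(** * Finite unitriangular groups *)

Lemma is_UT1 (F : fieldType) (n : nat) : is_UT (1%:M : 'M[F]_n).
Proof.
split=> [i | i j lji]; rewrite mxE ?eqxx // -val_eqE /=.
by rewrite gtn_eqF.
Qed.

Lemma is_UT_mul (F : fieldType) (n : nat) (x y : 'M[F]_n) :
  is_UT x -> is_UT y -> is_UT (x *m y).
Proof.
move=> [x1 x0] [y1 y0]; split=> [i | i j lji]; rewrite mxE.
  rewrite (bigD1 i) //= x1 y1 mulr1 big1 ?addr0 // => k nki.
  case: (ltngtP k i) => [lki | lik | /val_inj eki].
  - by rewrite x0 ?mul0r.
  - by rewrite y0 ?mulr0.
  - by rewrite eki eqxx in nki.
rewrite big1 // => k _; case: (ltnP k i) => [lki | lik]; first by rewrite x0 ?mul0r.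
by rewrite y0 ?mulr0 //; apply: leq_trans lik.
Qed.

Lemma is_UT_unitmx (F : fieldType) (n : nat) (x : 'M[F]_n) : is_UT x -> x \in unitmx.
Proof.
move=> [x1 x0]; rewrite unitmxE -det_tr det_trig.
  by rewrite big1 ?unitr1 // => i _; rewrite mxE.
by apply/is_trig_mxP => i j lij; rewrite mxE x0.
Qed.

Lemma is_UT_inv (F : fieldType) (n : nat) (x : 'M[F]_n) : is_UT x -> is_UT (invmx x).
Proof.
move=> Gx; have yx := mulVmx (is_UT_unitmx Gx); set y := invmx x in yx *.
have [x1 x0] := Gx.
have y0 (i j : 'I_n) : (j < i)%N -> y i j = 0.
  (* Induction on the column: in entry [(i, j)] of [y x = 1] the terms [k < j] vanish by induction
     and the terms [k > j] by triangularity of [x], leaving [y i j]. *)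
  elim/ltn_ind: {j}(val j) {-2}j (erefl (val j)) => m IH j ejm lji.
  have := congr1 (fun A : 'M_n => A i j) yx; rewrite !mxE -val_eqE gtn_eqF //=.
  rewrite (bigD1 j) //= x1 mulr1 big1 ?addr0 // => k nkj.
  case: (ltngtP k j) => [lkj | ljk | /val_inj ekj].
  - by rewrite (IH k) ?mul0r -?ejm //; apply: ltn_trans lji.
  - by rewrite x0 ?mulr0.
  - by rewrite ekj eqxx in nkj.
split=> // i; have := congr1 (fun A : 'M_n => A i i) yx; rewrite !mxE eqxx.
rewrite (bigD1 i) //= x1 mulr1 big1 ?addr0 // => k nki.
case: (ltngtP k i) => [lki | lik | /val_inj eki].
- by rewrite y0 ?mul0r.
- by rewrite x0 ?mulr0.
- by rewrite eki eqxx in nki.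
Qed.

Lemma PC_fin_preserves_comm (F : fieldType) (n : nat) (phi : 'M[F]_n -> 'M[F]_n) :
  is_PC_fin phi -> preserves_comm (@is_UT F n) (@mulmx F n n n) phi.
Proof.
apply: (@PC_map_preserves_comm _ _ _ _ 1%:M).
- exact: mulmxA.
- exact: is_UT_mul.
- exact: is_UT_inv.
- by move=> x _; rewrite mulmx1.
- by move=> x /is_UT_unitmx/mulmxV.
- by move=> x /is_UT_unitmx/mulVmx.
Qed.

(** * Column elements and multiplication by transvections *)

Definition colmx (F : fieldType) (n : nat) (l : 'I_n) (w : 'I_n -> F) : 'M[F]_n :=
  \matrix_(i, j) ((i == j)%:R + w i * (j == l)%:R).

Lemma mul_colmx (F : fieldType) (n : nat) (l : 'I_n) (w : 'I_n -> F) (y : 'M[F]_n) i j :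
  (colmx l w *m y) i j = y i j + w i * y l j.
Proof.
rewrite mxE; under eq_bigr => k _ do rewrite mxE mulrDl.
rewrite big_split /= (bigD1 i) //= eqxx mul1r big1 ?addr0; last first.
  by move=> k; rewrite eq_sym => /negbTE ->; rewrite mul0r.
rewrite (bigD1 l) //= eqxx mulr1 big1 ?addr0 //.
by move=> k /negbTE ->; rewrite mulr0 mul0r.
Qed.

Lemma tmx_colmx (F : fieldType) (n : nat) (k l : 'I_n) (c : F) :
  tmx k l c = colmx l (fun i => c * (i == k)%:R).
Proof. by apply/matrixP=> i j; rewrite !mxE mulrb; case: (i == k); case: (j == l); rewrite /= ?(mulr1, mulr0). Qed.

Lemma mul_mx_tmx (F : fieldType) (n : nat) (k l : 'I_n) (c : F) (y : 'M[F]_n) i j :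
  (y *m tmx k l c) i j = y i j + c * y i k * (j == l)%:R.
Proof.
rewrite /tmx mulmxDr mulmx1 -scalemxAr 3!mxE; congr (_ + _); rewrite -mulrA; congr (_ * _).
rewrite (bigD1 k) //= mxE eqxx /= big1 ?addr0 // => m /negbTE nmk.
by rewrite mxE nmk mulr0.
Qed.

Lemma mul_tmx (F : fieldType) (n : nat) (k l : 'I_n) (c : F) (y : 'M[F]_n) i j :
  (tmx k l c *m y) i j = y i j + c * (i == k)%:R * y l j.
Proof. by rewrite tmx_colmx mul_colmx. Qed.

Lemma is_UT_colmx (F : fieldType) (n : nat) (l : 'I_n) (w : 'I_n -> F) :
  (forall i : 'I_n, (l <= i)%N -> w i = 0) -> is_UT (colmx l w).
Proof.
move=> w0; split=> [i | i j lji]; rewrite mxE.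
  by rewrite eqxx; case: eqP => [-> | _]; rewrite ?mulr0 ?addr0 // w0 // mul0r addr0.
rewrite -val_eqE gtn_eqF //= add0r; case: eqP => [ejl | _]; last by rewrite mulr0.
by rewrite w0 ?mul0r // -ejl ltnW.
Qed.

Lemma is_UT_tmx (F : fieldType) (n : nat) (k l : 'I_n) (c : F) :
  (k < l)%N -> is_UT (tmx k l c).
Proof.
move=> lkl; rewrite tmx_colmx; apply: is_UT_colmx => i lli.
by rewrite -val_eqE gtn_eqF ?mulr0 //; apply: leq_trans lli.
Qed.

(* [ring] treats [true%:R] and [false%:R] as atoms. *)
Ltac ring_bool := rewrite ?mulr0n ?mulr1n; ring.

(** A commuting pair has the identity as commutator, and the identity is fixed because it is a
    transvection with coefficient 0. *)
Lemma commuting_preserved (F : fieldType) (n : nat) (phi : 'M[F]_n.+2 -> 'M[F]_n.+2) x y :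
  preserves_comm (@is_UT F _) (@mulmx F _ _ _) phi -> almost_id_fin phi ->
  is_UT x -> is_UT y -> x *m y = y *m x -> phi x *m phi y = phi y *m phi x.
Proof.
move=> [_ phiC] phit Gx Gy e.
have t0 : tmx ord0 ord_max 0 = 1%:M :> 'M[F]_n.+2 by rewrite /tmx scale0r addr0.
rewrite (phiC x y 1%:M) // ?mul1mx //; last exact: is_UT1.
by rewrite -t0 phit // t0 mul1mx.
Qed.

Lemma UT_last_row (F : fieldType) (n : nat) (x : 'M[F]_n.+2) j :
  is_UT x -> x ord_max j = (j == ord_max)%:R.
Proof.
move=> [x1 x0]; case: eqP => [-> | /eqP nj]; first by rewrite x1.
by apply: x0; rewrite ltn_neqAle -ltnS ltn_ord andbT; apply: contra nj => /eqP/val_inj ->.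
Qed.

Lemma UT_col_lower (F : fieldType) (n : nat) (x : 'M[F]_n) (i k : 'I_n) :
  is_UT x -> (i <= k)%N -> x k i = (k == i)%:R.
Proof.
move=> [x1 x0]; rewrite leq_eqVlt => /orP[/eqP/val_inj -> | lik]; first by rewrite x1 eqxx.
by rewrite x0 // -val_eqE gtn_eqF.
Qed.

Lemma ltn_ord_max (n : nat) (i : 'I_n.+1) : i != ord_max -> (i < @ord_max n)%N.
Proof. by move=> ni; rewrite ltn_neqAle -ltnS ltn_ord andbT -val_eqE in ni *. Qed.

(** Right multiplication by the transvection adds column [i] to the last column; left multiplication
    adds the last row, a unit vector, to row [i]. The column element accounts for the difference. *)
Lemma column_comm (F : fieldType) (n : nat) (a : 'M[F]_n.+2) i :
  is_UT a -> i != ord_max ->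
  a *m tmx i ord_max 1 =
    colmx ord_max (fun k => a k i - (k == i)%:R) *m (tmx i ord_max 1 *m a).
Proof.
move=> Ga ni; apply/matrixP => k j.
rewrite mul_mx_tmx mul_colmx !mul_tmx !UT_last_row // (eq_sym ord_max) (negbTE ni).
ring_bool.
Qed.

(** The image of the equation [column_comm] keeps the column element of [a]. In its entry
    [(k, ord_max)] the unknown [phi a k ord_max] cancels and [phi a k i] remains. *)
Lemma column_determined (F : fieldType) (n : nat) (phi : 'M[F]_n.+2 -> 'M[F]_n.+2) a i :
  preserves_comm (@is_UT F _) (@mulmx F _ _ _) phi -> almost_id_fin phi -> is_UT a ->
  i != ord_max ->
  phi (colmx ord_max (fun k => a k i - (k == i)%:R)) =
    colmx ord_max (fun k => a k i - (k == i)%:R) ->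
  forall k, phi a k i = a k i.
Proof.
move=> [phiG phiC] phit Ga ni e k; have lie := ltn_ord_max ni.
have Gu : is_UT (colmx ord_max (fun k => a k i - (k == i)%:R)).
  by apply: is_UT_colmx => m lm; rewrite UT_col_lower ?subrr //; apply: leq_trans lm; apply: ltnW.
have := phiC _ _ _ Ga (is_UT_tmx 1 lie) Gu (column_comm Ga ni).
rewrite e phit // => /matrixP/(_ k ord_max).
rewrite mul_mx_tmx mul_colmx !mul_tmx !UT_last_row ?eqxx; try exact: phiG.
rewrite (eq_sym ord_max) (negbTE ni) => h.
have -> : phi a k i = phi a k ord_max + 1 * phi a k i * true%:R - phi a k ord_max by ring_bool.
rewrite h; ring_bool.
Qed.

(** For such a row the commutator of [tmx ord0 k 1] with [a] is the fixed element
    [tmx ord0 ord_max c]; the image of this relation is read off in the corner. *)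
Lemma row_determined (F : fieldType) (n : nat) (phi : 'M[F]_n.+2 -> 'M[F]_n.+2) a k c :
  preserves_comm (@is_UT F _) (@mulmx F _ _ _) phi -> almost_id_fin phi -> is_UT a ->
  k != ord0 -> k != ord_max -> (forall j, a k j = (k == j)%:R + c * (j == ord_max)%:R) ->
  phi a k ord_max = c.
Proof.
move=> [phiG phiC] phit Ga k0 ke rk.
have lk : (@ord0 n.+1 < k)%N by rewrite lt0n -val_eqE in k0 *.
have l0 : (@ord0 n.+1 < @ord_max n.+1)%N by [].
have col0 (x : 'M[F]_n.+2) i : is_UT x -> x i ord0 = (i == ord0)%:R.
  by move=> Gx; rewrite UT_col_lower.
have h : tmx ord0 k 1 *m a = tmx ord0 ord_max c *m (a *m tmx ord0 k 1).
  apply/matrixP => i j; rewrite !mul_tmx !mul_mx_tmx !UT_last_row // rk !col0 //.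
  by rewrite (eq_sym j k) -[ord0 == ord_max]val_eqE /=; ring_bool.
have := phiC _ _ _ (is_UT_tmx 1 lk) Ga (is_UT_tmx c l0) h.
rewrite !phit // => /matrixP/(_ ord0 ord_max).
rewrite !mul_tmx !mul_mx_tmx !UT_last_row ?col0 //; try exact: phiG.
rewrite !eqxx (eq_sym ord_max k) (negbTE ke) => e.
have -> : phi a k ord_max = phi a ord0 ord_max + 1 * true%:R * phi a k ord_max -  phi a ord0 ord_max by ring_bool.
rewrite e; ring_bool.
Qed.

(** The column element commutes with every [tmx i ord_max 1], which makes all columns of its image
    trivial except the last; [row_determined] recovers the entries below the top one. The top entry
    is central, so commutators do not see it. *)
Lemma colmx_max_off0 (F : fieldType) (n : nat) (phi : 'M[F]_n.+2 -> 'M[F]_n.+2) w :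
  preserves_comm (@is_UT F _) (@mulmx F _ _ _) phi -> almost_id_fin phi ->
  w ord_max = 0 ->
  exists2 v, phi (colmx ord_max w) = colmx ord_max v & forall k, k != ord0 -> v k = w k.
Proof.
move=> phiP phit we; have [phiG phiC] := phiP.
have Gb : is_UT (colmx ord_max w).
  apply: is_UT_colmx => i le; suff -> : i = ord_max by [].
  by apply/val_inj/eqP; rewrite eqn_leq le -ltnS ltn_ord.
set b := colmx _ _ in Gb *; have Gpb := phiG _ Gb.
exists (fun k => phi b k ord_max - (k == ord_max)%:R).
  apply/matrixP => k i; rewrite [RHS]mxE.
  case: (eqVneq i ord_max) => [-> | ni]; first by rewrite mulr1; ring_bool.
  rewrite mulr0 addr0; have lie := ltn_ord_max ni.
  have Gt := is_UT_tmx (1 : F) lie.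
  have e : b *m tmx i ord_max 1 = tmx i ord_max 1 *m b.
    apply/matrixP => r s; rewrite mul_tmx mul_mx_tmx UT_last_row // /b !mxE (negbTE ni).
    ring_bool.
  have := commuting_preserved phiP phit Gb Gt e; rewrite phit // => /matrixP/(_ k ord_max).
  by rewrite mul_tmx mul_mx_tmx UT_last_row // eqxx !(mulr1, mul1r) => /addrI.
move=> k k0; case: (eqVneq k ord_max) => [-> | ke].
  by rewrite we UT_last_row // eqxx subrr.
rewrite subr0; apply: row_determined => // j; rewrite /b mxE //.
Qed.

Lemma eq_colmx (F : fieldType) (n : nat) (l : 'I_n) (w v : 'I_n -> F) :
  w =1 v -> colmx l w = colmx l v.
Proof. by move=> e; apply/matrixP => i j; rewrite !mxE e. Qed.

Lemma column_determined_by (F : fieldType) (n : nat) (phi : 'M[F]_n.+2 -> 'M[F]_n.+2) a i w :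
  preserves_comm (@is_UT F _) (@mulmx F _ _ _) phi -> almost_id_fin phi -> is_UT a ->
  i != ord_max -> (forall k, a k i = (k == i)%:R + w k) ->
  phi (colmx ord_max w) = colmx ord_max w -> forall k, phi a k i = a k i.
Proof.
move=> phiP phit Ga ni e h; apply: column_determined => //.
have ew : (fun k => a k i - (k == i)%:R) =1 w by move=> k; rewrite e addrC addKr.
by rewrite (eq_colmx _ ew).
Qed.

(** This isolates an unknown last column. Since [v ord_max = 0], the last row of [colmx p v] is a
    unit vector, so the left factor alters only the last column. *)
Lemma factor_last_columns (F : fieldType) (n : nat) (x : 'M[F]_n.+2) (p : 'I_n.+2) v :
  is_UT x -> v ord_max = 0 -> p != ord_max ->
  (forall i j, j != ord_max -> x i j = (i == j)%:R + v i * (j == p)%:R) ->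
  x = colmx ord_max (fun i => x i ord_max - (i == ord_max)%:R) *m colmx p v.
Proof.
move=> Gx ve pe h; apply/matrixP => i j; rewrite mul_colmx !mxE ve.
have [-> | nj] := eqVneq j ord_max.
  by rewrite (eq_sym ord_max p) (negbTE pe); ring_bool.
by rewrite h //; ring_bool.
Qed.

(* Peeling off the entry [w m]: the column element is the commutator of [c] and [d], whose
   images are known outside the last column, and the unknown entries there cancel. *)
Lemma colmx_max_fixed (F : fieldType) (n : nat) (phi : 'M[F]_n.+2 -> 'M[F]_n.+2) (m : nat) w :
  preserves_comm (@is_UT F _) (@mulmx F _ _ _) phi -> almost_id_fin phi -> (m <= n)%N ->
  (forall i : 'I_n.+2, (m <= i)%N -> w i = 0) ->
  phi (colmx ord_max w) = colmx ord_max w.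
Proof.
move=> phiP phit; have [phiG phiC] := phiP.
elim: m w => [|m IH] w lmn w0.
  have ew : w =1 (fun i => 0 * (i == ord0)%:R) by move=> i; rewrite w0 // mul0r.
  by rewrite (eq_colmx _ ew) -tmx_colmx phit.
have {}IH v := IH v (ltnW lmn).
pose e : 'I_n.+2 := ord_max; pose p : 'I_n.+2 := inord n; pose mo : 'I_n.+2 := inord m.
have vp : val p = n by rewrite /= inordK.
have vm : val mo = m by rewrite /= inordK //; lia.
have ltmp : (mo < p)%N by rewrite -[nat_of_ord mo]/(val mo) -[nat_of_ord p]/(val p) vp vm.
have ltpe : (p < e)%N by rewrite -[nat_of_ord p]/(val p) vp /=.
have npe : p != e by rewrite -val_eqE ltn_eqF.
have nme : mo != e by rewrite -val_eqE ltn_eqF // (ltn_trans ltmp).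
have nmp : mo != p by rewrite -val_eqE ltn_eqF.
have np0 : p != ord0 by rewrite -val_eqE -lt0n vp /=; lia.
pose s := w mo; pose v (i : 'I_n.+2) := if i == mo then 0 else w i.
have v0 (i : 'I_n.+2) : (m <= i)%N -> v i = 0.
  rewrite /v; case: eqP => // ne li; apply: w0; rewrite ltn_neqAle li andbT.
  by apply/eqP => emi; apply: ne; apply: val_inj; rewrite vm.
have wE i : w i = v i + s * (i == mo)%:R.
  by rewrite /v /s; case: eqP => [-> | _]; ring_bool.
have ve : v e = 0 by apply: v0; apply: leq_trans (ltnW ltpe); rewrite -[nat_of_ord p]/(val p) vp ltnW.
have vpp : v p = 0 by apply: v0; rewrite -[nat_of_ord p]/(val p) vp ltnW.
have vmm : v mo = 0 by rewrite /v eqxx.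
(* In [c d - d c], the entry [s] at [(mo, p)] in [c] meets the 1 at [(p, e)] in [d] and gives [s] at
   [(mo, e)]; column [p] of [d], which is [v], meets the -1 at [(p, e)] in [c] and gives [v] in
   column [e]. *)
pose c := colmx e (fun i => - (i == p)%:R) *m tmx mo p s.
pose d := colmx e (fun i => (i == p)%:R) *m colmx p v.
have Gp k : is_UT (colmx e (fun i => k * (i == p)%:R) : 'M[F]_n.+2).
  by rewrite -tmx_colmx; apply: is_UT_tmx.
have Gc : is_UT c.
  apply: is_UT_mul; last exact: is_UT_tmx.
  have := Gp (-1); rewrite (@eq_colmx _ _ _ _ (fun i => - (i == p)%:R)) // => i.
  by rewrite mulN1r.
have Gd : is_UT d.
  apply: is_UT_mul.
    have := Gp 1; rewrite (@eq_colmx _ _ _ _ (fun i => (i == p)%:R)) // => i.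
    by rewrite mul1r.
  by apply: is_UT_colmx => i; rewrite -[nat_of_ord p]/(val p) vp => li; apply: v0; lia.
have Gw : is_UT (colmx e w).
  by apply: is_UT_colmx => i li; apply: w0; apply: leq_trans li => /=; lia.
have cE i j : c i j = (i == j)%:R + s * (i == mo)%:R * (j == p)%:R - (i == p)%:R * (j == e)%:R.
  rewrite /c tmx_colmx mul_colmx !mxE (eq_sym e mo) (negbTE nme) (eq_sym e j).
  by ring_bool.
have dE i j : d i j = (i == j)%:R + v i * (j == p)%:R + (i == p)%:R * (j == e)%:R.
  by rewrite /d mul_colmx !mxE ve (eq_sym e j); ring_bool.
have cdw : c *m d = colmx e w *m (d *m c).
  apply/matrixP => i j.
  rewrite /c tmx_colmx -!mulmxA !mul_colmx.
  rewrite !mxE wE ve !eqxx (eq_sym e p) (eq_sym e mo) (eq_sym p mo) (eq_sym e j) (eq_sym p j).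
  by rewrite vpp (negbTE npe) (negbTE nme) (negbTE nmp); ring_bool.
(* Off the diagonal, column [p] of [c] has the single entry [s], so its copy in the last column is a
   transvection; column [p] of [d] is [v], whose copy is fixed by induction. *)
have colc i j : j != e -> phi c i j = (i == j)%:R + s * (i == mo)%:R * (j == p)%:R.
  move=> nj; rewrite (@column_determined_by _ _ _ _ _
    (fun k => (s * (j == p)%:R) * (k == mo)%:R) phiP phit Gc nj).
  - by rewrite cE (negbTE nj); ring_bool.
  - by move=> k; rewrite cE (negbTE nj); ring_bool.
  - by rewrite -tmx_colmx phit // (ltn_trans ltmp).
have cold i j : j != e -> phi d i j = (i == j)%:R + v i * (j == p)%:R.
  move=> nj; rewrite (@column_determined_by _ _ _ _ _
    (fun k => v k * (j == p)%:R) phiP phit Gd nj).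
  - by rewrite dE (negbTE nj); ring_bool.
  - by move=> k; rewrite dE (negbTE nj); ring_bool.
  - by apply: IH => i' li; rewrite v0 ?mul0r.
have rowc : phi c p e = -1.
  apply: row_determined => // j; rewrite cE eq_sym (eq_sym p mo) (negbTE nmp) eqxx.
  by rewrite (eq_sym j p); ring_bool.
have rowd : phi d p e = 1.
  by apply: row_determined => // j; rewrite dE vpp eqxx; ring_bool.
have [Gpc Gpd] := (phiG _ Gc, phiG _ Gd).
have we : w e = 0 by rewrite wE ve (eq_sym e) (negbTE nme) mulr0 addr0.
have [u pu uw] := colmx_max_off0 phiP phit we.
have tme : s * (e == mo)%:R = 0 by rewrite (eq_sym e) (negbTE nme) mulr0.
have fc := factor_last_columns Gpc tme npe colc.
have fd := factor_last_columns Gpd ve npe cold.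
(* Only the top entry [u ord0] is still unknown. At [(ord0, e)] both [phi c ord0 e] and
   [phi d ord0 e] occur once on each side and cancel. *)
have := phiC _ _ _ Gc Gd Gw cdw; rewrite pu => /matrixP/(_ ord0 e).
rewrite {1}fc {2}fd -!mulmxA !mul_colmx rowc rowd tme ve !UT_last_row // !eqxx => h.
rewrite (@eq_colmx _ _ _ _ w) // => i.
case: (eqVneq i ord0) => [-> | /uw //].
rewrite wE -[u ord0](addKr (phi c ord0 e + phi d ord0 e - v ord0)).
set lhs := (X in X = _) in h.
have -> : phi c ord0 e + phi d ord0 e - v ord0 + u ord0 = lhs by rewrite h -[ord0 == _]val_eqE /=; ring_bool.
by rewrite /lhs -[ord0 == ord_max]val_eqE /=; ring_bool.
Qed.

Lemma columns_fixed (F : fieldType) (n : nat) (phi : 'M[F]_n.+2 -> 'M[F]_n.+2) a i j :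
  preserves_comm (@is_UT F _) (@mulmx F _ _ _) phi -> almost_id_fin phi -> is_UT a ->
  j != ord_max -> phi a i j = a i j.
Proof.
move=> phiP phit Ga nj; apply: column_determined => //.
have lj : (j <= n)%N by rewrite -ltnS; apply: (ltn_ord_max nj).
by apply: (colmx_max_fixed phiP phit lj) => k ljk; rewrite UT_col_lower // subrr.
Qed.

(** * The antidiagonal duality *)

(** The antitranspose [J x^T J]: unlike the transpose, it keeps upper triangular matrices upper
    triangular. *)
Definition flipmx (F : fieldType) (n : nat) (x : 'M[F]_n) : 'M[F]_n :=
  \matrix_(i, j) x (rev_ord j) (rev_ord i).

Lemma flipmxM (F : fieldType) (n : nat) (x y : 'M[F]_n) :
  flipmx (x *m y) = flipmx y *m flipmx x.
Proof.
apply/matrixP => i j; rewrite !mxE (reindex_inj rev_ord_inj) /=.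
by apply: eq_bigr => k _; rewrite !mxE mulrC.
Qed.

Lemma flipmxK (F : fieldType) (n : nat) : involutive (@flipmx F n).
Proof. by move=> x; apply/matrixP => i j; rewrite !mxE !rev_ordK. Qed.

Lemma flip_tmx (F : fieldType) (n : nat) (i j : 'I_n) (c : F) :
  flipmx (tmx i j c) = tmx (rev_ord j) (rev_ord i) c.
Proof.
apply/matrixP => k l; rewrite !mxE (inj_eq rev_ord_inj) (eq_sym l).
by rewrite !(can2_eq (@rev_ordK n) (@rev_ordK n)) andbC.
Qed.

Lemma flip_UT (F : fieldType) (n : nat) (x : 'M[F]_n) : is_UT x -> is_UT (flipmx x).
Proof.
move=> [x1 x0]; split=> [i | i j lji]; rewrite mxE // x0 //=.
by have := ltn_ord i; have := ltn_ord j; lia.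
Qed.

Lemma flip_inv (F : fieldType) (n : nat) (x : 'M[F]_n) :
  is_UT x -> flipmx (invmx x) = invmx (flipmx x).
Proof.
move=> Gx; have Ux := is_UT_unitmx Gx; have Uf := is_UT_unitmx (flip_UT Gx).
have f1 : flipmx 1%:M = 1%:M :> 'M[F]_n.
  by apply/matrixP => i j; rewrite !mxE (inj_eq rev_ord_inj) eq_sym.
by rewrite -[LHS]mul1mx -(mulVmx Uf) -mulmxA -flipmxM mulVmx // f1 mulmx1.
Qed.

Lemma inv_tmx (F : fieldType) (n : nat) (i j : 'I_n) (c : F) :
  (i < j)%N -> invmx (tmx i j c) = tmx i j (- c).
Proof.
move=> lij; have Ut := is_UT_unitmx (is_UT_tmx c lij).
rewrite -[RHS]mul1mx -(mulVmx Ut) -mulmxA; set y := _ *m tmx _ _ _.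
suff -> : y = 1%:M by rewrite mulmx1.
apply/matrixP => k l; rewrite mul_tmx !mxE; have -> : (j == i) = false.
  by rewrite -val_eqE gtn_eqF.
by rewrite (eq_sym l); case: (k == i); case: (j == l); ring_bool.
Qed.

(** Inversion and antitransposition both reverse products, so their composite is an automorphism; it
    turns rows of the inverse into columns. *)
Definition dualmx (F : fieldType) (n : nat) (x : 'M[F]_n) : 'M[F]_n := flipmx (invmx x).

Lemma dual_UT (F : fieldType) (n : nat) (x : 'M[F]_n) : is_UT x -> is_UT (dualmx x).
Proof. by move=> Gx; apply/flip_UT/is_UT_inv. Qed.

Lemma dualmxM (F : fieldType) (n : nat) (x y : 'M[F]_n) :
  is_UT x -> is_UT y -> dualmx (x *m y) = dualmx x *m dualmx y.
Proof.
move=> /is_UT_unitmx Ux /is_UT_unitmx Uy; rewrite /dualmx -flipmxM; congr flipmx.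
have Uxy : x *m y \in unitmx by rewrite unitmx_mul Ux.
rewrite -[RHS]mul1mx -(mulVmx Uxy) -!mulmxA (mulmxA y) (mulmxV Uy) mul1mx.
by rewrite (mulmxV Ux) mulmx1.
Qed.

Lemma dualmxK (F : fieldType) (n : nat) (x : 'M[F]_n) : is_UT x -> dualmx (dualmx x) = x.
Proof. by move=> Gx; rewrite /dualmx (flip_inv Gx) invmxK flipmxK. Qed.

Lemma dual_tmx (F : fieldType) (n : nat) (i j : 'I_n) (c : F) :
  (i < j)%N -> dualmx (tmx i j c) = tmx (rev_ord j) (rev_ord i) (- c).
Proof. by move=> lij; rewrite /dualmx inv_tmx // flip_tmx. Qed.

Lemma dual_preserves_comm (F : fieldType) (n : nat) (phi : 'M[F]_n -> 'M[F]_n) :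
  preserves_comm (@is_UT F _) (@mulmx F _ _ _) phi ->
  preserves_comm (@is_UT F _) (@mulmx F _ _ _) (fun x => dualmx (phi (dualmx x))).
Proof.
move=> [phiG phiC]; split=> [x Gx | x y z Gx Gy Gz e].
  exact/dual_UT/phiG/dual_UT.
have [[Dx Dy] Dz] := (dual_UT Gx, dual_UT Gy, dual_UT Gz).
have [[Px Py] Pz] := (phiG _ Dx, phiG _ Dy, phiG _ Dz).
rewrite -(dualmxM Px Py) -(dualmxM Py Px) -dualmxM //; last exact: is_UT_mul.
congr dualmx; apply: phiC => //; rewrite -(dualmxM Gx Gy) -(dualmxM Gy Gx) -dualmxM ?e //.
exact: is_UT_mul.
Qed.

Lemma dual_almost_id (F : fieldType) (n : nat) (phi : 'M[F]_n -> 'M[F]_n) :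
  almost_id_fin phi -> almost_id_fin (fun x => dualmx (phi (dualmx x))).
Proof.
move=> phit i j c lij; have lr : (rev_ord j < rev_ord i)%N.
  by have := ltn_ord j; rewrite /=; lia.
by rewrite dual_tmx // phit // -dual_tmx // dualmxK //; apply: is_UT_tmx.
Qed.

(** * From fixed columns and rows to the corner *)

Lemma almost_id_PC_fin (F : fieldType) (n : nat) (phi : 'M[F]_n.+2 -> 'M[F]_n.+2) a :
  preserves_comm (@is_UT F _) (@mulmx F _ _ _) phi -> almost_id_fin phi -> is_UT a ->
  phi a = a *m t1n n.+2 ((invmx a *m phi a) ord0 ord_max).
Proof.
move=> phiP phit Ga; have [phiG _] := phiP; have Gp := phiG _ Ga.
have [Ua Up] := (is_UT_unitmx Ga, is_UT_unitmx Gp).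
have rows i j : i != ord0 -> invmx (phi a) i j = invmx a i j.
  move=> ni; have nr : rev_ord i != ord_max.
    by rewrite -[ord_max]rev_ordK (inj_eq rev_ord_inj) -val_eqE /= subnn.
  (* Row [i] of the inverse of [phi a] is, reversed, column [rev_ord i] of the dual of [phi a]. *)
  have := columns_fixed (rev_ord j) (dual_preserves_comm phiP) (dual_almost_id phit) (dual_UT Ga) nr.
  by rewrite dualmxK // /dualmx !mxE !rev_ordK.
rewrite -[LHS]mul1mx -(mulmxV Ua) -mulmxA; congr (_ *m _).
set g := invmx a *m phi a; apply/matrixP => i j; rewrite [RHS]mxE.
have [ij0 | ] := boolP ((val i == 0%N) && (val j == n.+2.-1)).
  case/andP: ij0 => /eqP i0 /eqP j0.
  have -> : i = ord0 by apply: val_inj.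
  by have -> : j = ord_max by apply: val_inj.
rewrite negb_and => ij; have -> : g i j = (1%:M : 'M[F]_n.+2) i j; last first.
  by rewrite mxE; case: eqP.
(* Off the first row, [invmx a] may be replaced by [invmx (phi a)]; off the last column, [phi a] may
   be replaced by [a]. Either way the product becomes the identity. *)
case/orP: ij => [ni | nj].
  rewrite -(mulVmx Up) !mxE; by apply: eq_bigr => k _; rewrite rows.
rewrite -(mulVmx Ua) !mxE; by apply: eq_bigr => k _; rewrite (columns_fixed k phiP phit Ga nj).
Qed.

Lemma t1n_center (F : fieldType) (n : nat) (c : F) : in_center_fin (t1n n.+2 c).
Proof.
have l0 : (@ord0 n.+1 < @ord_max n.+1)%N by [].
have -> : t1n n.+2 c = tmx ord0 ord_max c.
  apply/matrixP => i j; rewrite !mxE -!val_eqE /=.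
  by case: (ltngtP i j) => [lt | gt | <-]; do ?case: eqP; move=> *; rewrite ?(mulr0, mulr1, addr0, add0r) //=; lia.
split=> [|x Gx]; first exact: is_UT_tmx.
apply/matrixP => i j; rewrite mul_tmx mul_mx_tmx UT_last_row // (UT_col_lower (i := ord0)) //; ring_bool.
Qed.

Lemma UT1_trivial (F : fieldType) (n : nat) (x : 'M[F]_n) : (n <= 1)%N -> is_UT x -> x = 1%:M.
Proof.
move=> n1 [x1 x0]; apply/matrixP => i j.
have -> : i = j by apply: val_inj; have := ltn_ord i; have := ltn_ord j; rewrite /=; lia.
by rewrite x1 mxE eqxx.
Qed.

(** * The infinite unitriangular group *)

Definition oneI (F : fieldType) : imx F := fun i j => (i == j)%:R.

Definition colI (F : fieldType) (l : nat) (w : nat -> F) : imx F :=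
  fun i j => (i == j)%:R + w i * (j == l)%:R.

Lemma imxP (F : fieldType) (A B : imx F) : (forall i j, A i j = B i j) -> A = B.
Proof. by move=> e; do 2![apply: functional_extensionality => ?]. Qed.

Lemma sum_nat_delta (F : fieldType) (m n l : nat) (f : nat -> F) :
  \sum_(m <= k < n) (k == l)%:R * f k = (m <= l < n)%N%:R * f l.
Proof.
have [ln | nln] := boolP (m <= l < n)%N; last first.
  rewrite mul0r big_nat big1 // => k ln; case: eqP => [ek | _]; last by rewrite mul0r.
  by rewrite -ek ln in nln.
rewrite (bigD1_seq l) ?iota_uniq ?mem_index_iota //= eqxx big1 ?addr0 // => k /negbTE ->.
by rewrite mul0r.
Qed.

(** Both bracketings are the sum over [i <= k <= l <= j]; the inner ranges are widened to a common
    one so that the sums can be exchanged. *)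
Lemma mulIA (F : fieldType) : associative (@mulI F).
Proof.
move=> A B C; apply: imxP => i j; rewrite /mulI.
transitivity (\sum_(i <= k < j.+1) \sum_(i <= l < j.+1 | (k <= l)%N) A i k * B k l * C l j).
  apply: eq_big_nat => k /andP[lik _]; rewrite (big_nat_widenl _ _ _ _ _ lik) /= big_distrr /=.
  by apply: eq_bigr => l _; rewrite mulrA.
rewrite (exchange_big_dep_nat xpredT) //=; apply: eq_big_nat => l /andP[_ llj].
by rewrite (big_nat_widen _ _ _ _ _ llj) /= big_distrl.
Qed.

(** The defining sum reaches the term [k = l] only when [i <= l <= j]; in all other cases [w i] or
    [y l j] vanishes, so the row operation formula still holds. *)
Lemma mul_colI (F : fieldType) (l : nat) (w : nat -> F) (y : imx F) i j :
  is_UTI y -> (forall k, (l <= k)%N -> w k = 0) ->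
  mulI (colI l w) y i j = y i j + w i * y l j.
Proof.
move=> [_ y0] w0; rewrite /mulI.
under eq_bigr => k _ do rewrite /colI mulrDl (eq_sym i) -mulrA.
rewrite big_split /= -big_distrr /= !sum_nat_delta leqnn /= ltnS.
case: (leqP i j) => [lij | lji].
  rewrite mul1r; congr (_ + _); case: (leqP l j) => [llj | ljl].
    rewrite ltnS llj andbT; case: (leqP i l) => [_ | lli]; first by rewrite mul1r.
    by rewrite (w0 i (ltnW lli)) !mul0r.
  by rewrite (y0 l j) // !mulr0.
rewrite mul0r (y0 i j lji); case: (leqP l i) => [lli | lil]; first by rewrite (w0 i lli) !mul0r add0r.
by rewrite (y0 l j) ?mulr0 //; apply: ltn_trans lil.
Qed.

Lemma tI_colI (F : fieldType) (k l : nat) (c : F) :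
  tI k l c = colI l (fun i => c * (i == k)%:R).
Proof.
apply: imxP => i j; rewrite /tI /colI.
by case: (i == j); case: (i == k); case: (j == l); rewrite /= ?(mulr0, mulr1).
Qed.

Lemma mul_tI (F : fieldType) (k l : nat) (c : F) (y : imx F) i j :
  is_UTI y -> (k < l)%N -> mulI (tI k l c) y i j = y i j + c * (i == k)%:R * y l j.
Proof.
move=> Gy lkl; rewrite tI_colI mul_colI // => m llm.
by rewrite gtn_eqF ?mulr0 //; apply: leq_trans llm.
Qed.

Lemma mul_mx_tI (F : fieldType) (k l : nat) (c : F) (y : imx F) i j :
  is_UTI y -> (k < l)%N -> mulI y (tI k l c) i j = y i j + c * y i k * (j == l)%:R.
Proof.
move=> [_ y0] lkl; rewrite tI_colI /mulI /colI.
rewrite (eq_bigr (fun m => (m == j)%:R * y i m + (m == k)%:R * y i m * (c * (j == l)%:R)));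
  last by move=> m _; ring.
rewrite big_split /= -big_distrl /= !sum_nat_delta ltnS leqnn andbT.
have -> : (i <= j)%N%:R * y i j = y i j.
  by case: leqP => [_ | lji]; rewrite ?mul1r // y0 ?mulr0.
congr (_ + _); have [-> | _] := eqVneq j l; last by rewrite !mulr0.
rewrite ltnS (ltnW lkl) andbT; case: leqP => [_ | lki]; first by ring_bool.
by rewrite y0 //; ring_bool.
Qed.

Lemma is_UTI1 (F : fieldType) : is_UTI (@oneI F).
Proof. by split=> [i | i j lji]; rewrite /oneI ?eqxx // gtn_eqF. Qed.

Lemma mul1I (F : fieldType) (x : imx F) : is_UTI x -> mulI (@oneI F) x = x.
Proof.
move=> [_ x0]; apply: imxP => i j; rewrite /mulI /oneI.
under eq_bigr => k _ do rewrite (eq_sym i).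
rewrite sum_nat_delta leqnn ltnS /=; case: leqP => [_ | lji]; first by rewrite mul1r.
by rewrite x0 ?mulr0.
Qed.

Lemma mulI1 (F : fieldType) (x : imx F) : is_UTI x -> mulI x (@oneI F) = x.
Proof.
move=> [_ x0]; apply: imxP => i j; rewrite /mulI /oneI.
under eq_bigr => k _ do rewrite mulrC.
rewrite sum_nat_delta leqnn andbT; case: leqP => [_ | lji]; first by rewrite mul1r.
by rewrite x0 ?mulr0.
Qed.

Lemma is_UTI_mul (F : fieldType) (x y : imx F) : is_UTI x -> is_UTI y -> is_UTI (mulI x y).
Proof.
move=> [x1 x0] [y1 y0]; split=> [i | i j lji]; rewrite /mulI.
  by rewrite big_nat1 x1 y1 mulr1.
by rewrite big_geq.
Qed.

(** * Inverses in the infinite group *)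

Lemma size_invrowI (F : fieldType) (A : imx F) i d : size (invrowI A i d) = d.+1.
Proof. by elim: d => //= d IH; rewrite size_rcons IH. Qed.

Lemma nth_invrowI (F : fieldType) (A : imx F) i d k :
  (k <= d)%N -> (invrowI A i d)`_k = (invrowI A i k)`_k.
Proof.
elim: d => [|d IH]; first by rewrite leqn0 => /eqP ->.
rewrite leq_eqVlt => /orP[/eqP -> // | lkd].
by rewrite /= nth_rcons size_invrowI lkd IH.
Qed.

Lemma is_UTI_inv (F : fieldType) (x : imx F) : is_UTI (invI x).
Proof. by split=> [i | i j lji]; rewrite /invI ?ltnn ?subnn // lji. Qed.

Lemma invI_rec (F : fieldType) (x : imx F) i d :
  invI x i (i + d.+1) = - \sum_(k < d.+1) invI x i (i + k) * x (i + k)%N (i + d.+1)%N.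
Proof.
rewrite /invI ltnNge leq_addr /= addKn nth_rcons size_invrowI ltnn eqxx; congr (- _).
apply: eq_bigr => k _; rewrite ltnNge leq_addr /= addKn (nth_invrowI _ _ (d := d)) //.
by rewrite -ltnS.
Qed.

Lemma mulVI (F : fieldType) (x : imx F) : is_UTI x -> mulI (invI x) x = @oneI F.
Proof.
move=> [x1 x0]; apply: imxP => i j; rewrite /oneI; case: (ltngtP i j) => [lij | lji | <-].
- rewrite /mulI big_nat_recr; last exact: ltnW.
  have [d ->] : exists d, j = (i + d.+1)%N by exists (j - i).-1; lia.
  rewrite /= x1 mulr1 invI_rec -[X in \sum_(X <= _ < _) _]add0n big_addn addKn big_mkord.
  under eq_bigr => k _ do rewrite addnC.
  exact: subrr.
- by rewrite /mulI big_geq.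
- by rewrite /mulI big_nat1 x1 mulr1 /invI ltnn subnn.
Qed.

(** The recursion yields a left inverse. As [invI x] itself has a left inverse, associativity
    identifies the latter with [x]. *)
Lemma mulIV (F : fieldType) (x : imx F) : is_UTI x -> mulI x (invI x) = @oneI F.
Proof.
move=> Gx; have Gy := is_UTI_inv x; have e := mulVI Gy.
suff xE : invI (invI x) = x by rewrite -{1}xE.
by rewrite -[LHS](mulI1 (is_UTI_inv _)) -(mulVI Gx) mulIA e mul1I.
Qed.

Lemma PC_inf_preserves_comm (F : fieldType) (phi : imx F -> imx F) :
  is_PC_inf phi -> preserves_comm (@is_UTI F) (@mulI F) phi.
Proof.
apply: (@PC_map_preserves_comm _ _ _ _ (@oneI F)).
- exact: mulIA.
- exact: is_UTI_mul.
- by move=> x _; apply: is_UTI_inv.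
- exact: mulI1.
- exact: mulIV.
- exact: mulVI.
Qed.

(** * Recovering columns without a last index *)

Lemma is_UTI_colI (F : fieldType) (l : nat) (w : nat -> F) :
  (forall i, (l <= i)%N -> w i = 0) -> is_UTI (colI l w).
Proof.
move=> w0; split=> [i | i j lji]; rewrite /colI.
  by rewrite eqxx; case: eqP => [-> | _]; rewrite ?mulr0 ?addr0 // w0 // mul0r addr0.
rewrite gtn_eqF // add0r; case: eqP => [ejl | _]; last by rewrite mulr0.
by rewrite w0 ?mul0r // -ejl ltnW.
Qed.

Lemma is_UTI_tI (F : fieldType) (k l : nat) (c : F) : (k < l)%N -> is_UTI (tI k l c).
Proof.
move=> lkl; rewrite tI_colI; apply: is_UTI_colI => i lli.
by rewrite gtn_eqF ?mulr0 //; apply: leq_trans lli.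
Qed.

Lemma UTI_lower (F : fieldType) (x : imx F) i j :
  is_UTI x -> (j <= i)%N -> x i j = (i == j)%:R.
Proof.
by move=> [x1 x0]; case: ltngtP => // [lji | ->] _; rewrite ?x1 // x0.
Qed.

(** An index [q > l] whose row in [z] is a unit vector stands in for the last index. The image
    relation is compared at [(k, q)], where [phi z q q = 1] and [phi z k q] cancels. *)
Lemma columnI_determined (F : fieldType) (phi : imx F -> imx F) z l q w :
  preserves_comm (@is_UTI F) (@mulI F) phi -> almost_id_inf phi -> is_UTI z ->
  (l < q)%N -> (forall j, z q j = (q == j)%:R) -> (forall k, z k l = (k == l)%:R + w k) ->
  phi (colI q w) = colI q w -> forall k, phi z k l = z k l.
Proof.
move=> [phiG phiC] phit Gz llq zq zl fixw k.
have w0 i : (q <= i)%N -> w i = 0.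
  move=> lqi; apply: (addrI (i == l)%:R); rewrite -zl addr0 UTI_lower //.
  exact: leq_trans (ltnW llq) lqi.
have Gw := is_UTI_colI w0; have Gt := is_UTI_tI (1 : F) llq.
have e : mulI z (tI l q 1) = mulI (colI q w) (mulI (tI l q 1) z).
  apply: imxP => i j; rewrite mul_colI //; last exact: is_UTI_mul.
  rewrite !mul_tI // mul_mx_tI // zl zq (gtn_eqF llq) (eq_sym q j); ring_bool.
have := phiC _ _ _ Gz Gt Gw e; have Gp := phiG _ Gz.
rewrite fixw phit // => /(congr1 (fun A : imx F => A k q)) /=.
rewrite mul_colI //; last exact: is_UTI_mul.
rewrite !mul_tI // mul_mx_tI // (UTI_lower Gp (leqnn q)) eqxx (gtn_eqF llq) zl => h.
have -> : phi z k l = phi z k q + 1 * phi z k l * true%:R - phi z k q by ring_bool.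
by rewrite h; ring_bool.
Qed.

Lemma mulI_cancel (F : fieldType) (x y z : imx F) :
  is_UTI x -> is_UTI y -> is_UTI z -> mulI x z = mulI y z -> x = y.
Proof.
move=> Gx Gy Gz e; rewrite -[x]mulI1 // -[y]mulI1 // -(mulIV Gz) !mulIA.
by rewrite e.
Qed.

(* Peeling off the entry [w m]: the column element is the commutator of [c] and [d]; here
   [c] is fixed, and [d] can only change in the entry [(0, l)], which commutes with [c]. *)
Lemma colI_fixed (F : fieldType) (phi : imx F -> imx F) (m l : nat) w :
  preserves_comm (@is_UTI F) (@mulI F) phi -> almost_id_inf phi -> (m.+1 < l)%N ->
  (forall i, (m <= i)%N -> w i = 0) -> phi (colI l w) = colI l w.
Proof.
move=> phiP phit; have [phiG phiC] := phiP.
have fix0 q : (0 < q)%N -> phi (colI q (fun=> 0)) = colI q (fun=> 0).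
  move=> q0; have -> : colI q (fun=> 0) = tI 0 q 0 :> imx F.
    by rewrite tI_colI; apply: imxP => i j; rewrite /colI; ring.
  exact: phit.
elim: m l w => [|m IH] l w lml w0.
  have -> : colI l w = colI l (fun=> 0) by apply: imxP => i j; rewrite /colI w0.
  by apply: fix0; lia.
pose p := m.+1; pose q := m.+2; pose s := w m.
pose v i := if i == m then 0 else w i.
have v0 i : (m <= i)%N -> v i = 0.
  by rewrite leq_eqVlt /v eq_sym => /orP[-> // | lmi]; rewrite gtn_eqF // w0.
have wE i : w i = v i + s * (i == m)%:R.
  by rewrite /v /s; case: eqP => [-> | _]; ring_bool.
have lmp : (m < p)%N by []. have lpl : (p < l)%N by apply: ltnW.
have lmq : (m < q)%N by rewrite /q; lia. have lpq : (p < q)%N by [].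
have vp i : (p <= i)%N -> v i = 0 by move=> li; apply: v0; apply: leq_trans li.
have wl i : (l <= i)%N -> w i = 0 by move=> li; apply: w0; apply: leq_trans li; lia.
(* Two auxiliary indices keep the parts of [w] apart: [c] carries [v] in column [p] and [s] in
   column [q], and multiplying by [d] on the right adds both columns to column [l]. *)
pose c := mulI (colI p v) (tI m q s); pose d := colI l (fun i => (i == p)%:R + (i == q)%:R) : imx F.
have Gc : is_UTI c by apply: is_UTI_mul; [apply: is_UTI_colI | apply: is_UTI_tI].
have d0 i : (l <= i)%N -> (i == p)%:R + (i == q)%:R = 0 :> F.
  by move=> li; rewrite !gtn_eqF ?addr0 //; lia.
have Gd : is_UTI d := is_UTI_colI d0.
have cE i j : c i j = (i == j)%:R + s * (i == m)%:R * (j == q)%:R + v i * (j == p)%:R.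
  rewrite /c mul_colI //; last exact: is_UTI_tI.
  by rewrite tI_colI /colI (eq_sym p j) (gtn_eqF lmp); ring_bool.
have phic : phi c = c.
  (* [Q] exceeds [j] and every row where [c] differs from the identity, and leaves the room that the
     induction hypothesis asks for. *)
  apply: imxP => i j; pose Q := (m + j + 5)%N.
  apply: (columnI_determined (l := j) (q := Q) (w := fun k => s * (j == q)%:R * (k == m)%:R + v k * (j == p)%:R)) => //.
  - by rewrite /Q; lia.
  - have lmQ : (m < Q)%N by rewrite /Q; lia.
    by move=> k; rewrite cE (gtn_eqF lmQ) (v0 Q (ltnW lmQ)); ring_bool.
  - by move=> k; rewrite cE; ring_bool.
  - have [-> | nj] := eqVneq j p.
      have -> : colI Q (fun k => s * (p == q)%:R * (k == m)%:R + v k * true%:R) = colI Q v.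
        by apply: imxP => a b; rewrite /colI (ltn_eqF lpq); ring_bool.
      by apply: IH => //; rewrite /Q; lia.
    have -> : colI Q (fun k => s * (j == q)%:R * (k == m)%:R + v k * false%:R) =
              tI m Q (s * (j == q)%:R).
      by rewrite tI_colI; apply: imxP => a b; rewrite /colI; ring_bool.
    by apply: phit; rewrite /Q; lia.
have cold i j : j != l -> phi d i j = (i == j)%:R.
  move=> nj; pose Q := (l + j + 5)%N.
  have e k : d k j = (k == j)%:R by rewrite /d /colI (negbTE nj) mulr0 addr0.
  rewrite (columnI_determined (l := j) (q := Q) (w := fun=> 0) phiP phit Gd) //.
  - by rewrite /Q; lia.
  - by move=> k; rewrite /d /colI d0 ?mul0r ?addr0 // /Q; lia.
  - by move=> k; rewrite e addr0.
  - by apply: fix0; rewrite /Q; lia.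
have Gpd := phiG _ Gd.
(* For these [k] the commutator of [tI 0 k 1] with [d] is [tI 0 l 1], which is fixed; entry [(0, l)]
   of the image relation yields the value. *)
have rowd k : (0 < k)%N -> (k == p) || (k == q) -> phi d k l = 1.
  move=> k0 kpq; have lkl : (k < l)%N by case/orP: kpq => /eqP ->.
  have l0 : (0 < l)%N by lia.
  have e : mulI (tI 0 k 1) d = mulI (tI 0 l 1) (mulI d (tI 0 k 1)).
    apply: imxP => i j; rewrite !mul_tI //; last by apply: is_UTI_mul => //; apply: is_UTI_tI.
    rewrite !mul_mx_tI // /d /colI.
    have -> : (k == p)%:R + (k == q)%:R = 1 :> F.
      by case/orP: kpq => /eqP ->; rewrite eqxx ?(ltn_eqF lpq) ?(gtn_eqF lpq) ?addr0 ?add0r.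
    rewrite (d0 l (leqnn l)) (gtn_eqF l0) (ltn_eqF l0) (eq_sym j k) (eq_sym l j); ring_bool.
  have := phiC _ _ _ (is_UTI_tI 1 k0) Gd (is_UTI_tI 1 l0) e.
  rewrite !phit // => /(congr1 (fun A : imx F => A 0%N l)) /=.
  rewrite !mul_tI //; last by apply: is_UTI_mul => //; apply: is_UTI_tI.
  rewrite !mul_mx_tI // (UTI_lower Gpd (leqnn l)) !eqxx (gtn_eqF lkl) => h.
  have -> : phi d k l = phi d 0%N l + 1 * true%:R * phi d k l - phi d 0%N l by ring_bool.
  by rewrite h; ring_bool.
pose u i := phi d i l - (i == l)%:R.
have u0 i : (l <= i)%N -> u i = 0 by move=> li; rewrite /u UTI_lower // subrr.
have dE : phi d = colI l u.
  apply: imxP => i j; rewrite /colI; have [-> | nj] := eqVneq j l.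
    by rewrite /u; ring_bool.
  by rewrite cold // mulr0 addr0.
have up : u p = 1 by rewrite /u rowd // ?eqxx // (ltn_eqF lpl) subr0.
have uq : u q = 1 by rewrite /u rowd // ?eqxx ?orbT // (ltn_eqF lml) subr0.
have Gu := is_UTI_colI u0; have Gw := is_UTI_colI wl.
have Gqd t : (forall i, (l <= i)%N -> t i = 0) -> is_UTI (mulI (colI l t) c).
  by move=> t0; apply: is_UTI_mul => //; apply: is_UTI_colI.
(* Stated for any column with entries 1 at [p] and [q], so as to apply both to [d] and to
   [phi d]. *)
have key t : (forall i, (l <= i)%N -> t i = 0) -> t p = 1 -> t q = 1 ->
    mulI c (colI l t) = mulI (colI l w) (mulI (colI l t) c).
  move=> t0 tp tq; apply: imxP => i j; have Gt := is_UTI_colI t0.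
  have Gm : is_UTI (tI m q s) by apply: is_UTI_tI.
  rewrite {1}/c -mulIA !mul_colI ?mul_tI //; try exact: Gqd; try exact: is_UTI_mul.
  rewrite wE !cE /colI tp tq (t0 l (leqnn l)) (v0 l); last exact/ltnW/(ltn_trans lmp).
  rewrite (gtn_eqF lmp) (gtn_eqF (ltn_trans lmp lpl)) (eq_sym p) (eq_sym q) (eq_sym l).
  ring_bool.
have h := phiC _ _ _ Gc Gd Gw (key _ d0 _ _).
(* [phi (colI l w)] and [colI l w] both multiply [phi d * c] to [c * phi d], hence agree. *)
apply: (@mulI_cancel _ _ _ (mulI (phi d) c)); first exact: phiG.
- by [].
- exact: is_UTI_mul.
rewrite -{1}phic -h ?phic ?dE ?key //; rewrite eqxx ?(ltn_eqF lpq) ?(gtn_eqF lpq) ?addr0 ?add0r //.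
Qed.

(** The conjugate of the transvection by [x] differs from the identity by column [k] of [x] times
    row [l] of its inverse. The terms are grouped so that the middle one vanishes at [j = l], where
    column [k] of [x] remains. *)
Lemma commI_tI_entries (F : fieldType) (x z : imx F) k l i j :
  is_UTI x -> is_UTI z -> (k < l)%N -> mulI x (tI k l 1) = mulI z (mulI (tI k l 1) x) ->
  z i j = (i == j)%:R + x i k * (invI x l j - (j == l)%:R) + (x i k - (i == k)%:R) * (j == l)%:R.
Proof.
move=> Gx Gz lkl e; have Gb := is_UTI_inv x; have Gt := is_UTI_tI (1 : F) lkl.
have zt : mulI z (tI k l 1) = mulI (mulI x (tI k l 1)) (invI x).
  by rewrite e -!mulIA mulIV // mulI1.
have {}zt r s : z r s + z r k * (s == l)%:R = (r == s)%:R + x r k * invI x l s.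
  rewrite -[z r k]mul1r -mul_mx_tI // zt.
  have -> : (r == s)%:R = mulI x (invI x) r s by rewrite mulIV.
  transitivity (\sum_(r <= m < s.+1) (x r m * invI x m s + x r k * ((m == l)%:R * invI x m s))).
    by apply: eq_bigr => m _; rewrite mul_mx_tI //; ring.
  rewrite big_split /= -big_distrr /= sum_nat_delta; congr (_ + _).
  have [lls | lsl] := leqP l s; last by rewrite (Gb.2 l s) // !mulr0.
  rewrite ltnS lls andbT; have [_ | llr] := leqP r l; first by rewrite mul1r.
  by rewrite (Gx.2 r k) ?mul0r //; apply: ltn_trans llr.
(* Column [k] of [z] is trivial because [invI x l k = 0], which makes the removal of the
   transvection explicit. *)
have zk : z i k = (i == k)%:R.
  by have := zt i k; rewrite (ltn_eqF lkl) (Gb.2 l k) // !mulr0 !addr0.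
have -> : z i j = z i j + z i k * (j == l)%:R - z i k * (j == l)%:R by ring.
rewrite zt zk; ring.
Qed.

(** No row of [a] need be trivial, so [columnI_determined] is applied to the commutator [z] of [a]
    with a transvection: its rows below [k] are trivial and its column [l] carries column [k] of
    [a]. *)
Lemma almost_id_PC_inf (F : fieldType) (phi : imx F -> imx F) a :
  preserves_comm (@is_UTI F) (@mulI F) phi -> almost_id_inf phi -> is_UTI a -> phi a = a.
Proof.
move=> phiP phit Ga; have [phiG phiC] := phiP; apply: imxP => i k.
pose l := k.+1; have lkl : (k < l)%N by [].
have Gt := is_UTI_tI (1 : F) lkl.
pose z := mulI (mulI a (tI k l 1)) (invI (mulI (tI k l 1) a)).
have Gta := is_UTI_mul Gt Ga.
have Gz : is_UTI z by apply: is_UTI_mul; [apply: is_UTI_mul | apply: is_UTI_inv].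
have e : mulI a (tI k l 1) = mulI z (mulI (tI k l 1) a).
  by rewrite -mulIA mulVI // mulI1 //; apply: is_UTI_mul.
have := phiC _ _ _ Ga Gt Gz e; rewrite phit // => pe.
have zE := commI_tI_entries _ _ Ga Gz lkl e.
have pzE := commI_tI_entries _ _ (phiG _ Ga) (phiG _ Gz) lkl pe.
have zl r : z r l = (r == l)%:R + (a r k - (r == k)%:R).
  by rewrite zE (UTI_lower (is_UTI_inv a) (leqnn l)) !eqxx; ring_bool.
have : phi z i l = z i l.
  (* [l.+1], that is [k + 2], is the least index at which [colI_fixed] covers a column supported
     above row [k]. *)
  apply: (columnI_determined (q := l.+1) phiP phit Gz _ _ zl) => //.
    have lkq : (k < l.+1)%N by apply: ltnW.
    by move=> j; rewrite zE (Ga.2 l.+1 k) // (gtn_eqF lkq); ring_bool.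
  apply: (colI_fixed phiP phit (m := k)) => // r lkr.
  by rewrite UTI_lower // subrr.
rewrite pzE zl (UTI_lower (is_UTI_inv _) (leqnn l)) eqxx => h.
have -> : phi a i k = (i == l)%:R + phi a i k * (true%:R - true%:R) +
  (phi a i k - (i == k)%:R) * true%:R - (i == l)%:R + (i == k)%:R by ring_bool.
by rewrite h; ring.
Qed.

Theorem mainTheorem12 :
  (* finite n *)
  (forall (F : fieldType) (n : nat) (phi : 'M[F]_n -> 'M[F]_n),
     is_PC_fin phi -> almost_id_fin phi ->
     (exists f : 'M[F]_n -> 'M[F]_n,
        forall a, is_UT a -> in_center_fin (f a) /\ phi a = a *m f a) /\
     ((1 < n)%N ->
        exists f : 'M[F]_n -> F,
          forall a, is_UT a -> phi a = a *m t1n n (f a)))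
  /\
  (* n = infinity *)
  (forall (F : fieldType) (phi : imx F -> imx F),
     is_PC_inf phi -> almost_id_inf phi ->
     (exists f : imx F -> imx F,
        forall a, is_UTI a -> in_center_inf (f a) /\ phi a = mulI a (f a)) /\
     (forall a, is_UTI a -> phi a = a)).
Proof.
split=> [F n phi PC phit | F phi PC phit].
  have phiP := PC_fin_preserves_comm PC.
  case: (leqP n 1) => [n1 | ].
    split=> //; exists (fun=> 1%:M) => a Ga.
    split; first by split=> [|x _]; [exact: is_UT1 | rewrite mulmx1 mul1mx].
    by rewrite (UT1_trivial n1 Ga) mulmx1; apply/(UT1_trivial n1)/phiP.1/is_UT1.
  case: n phi PC phit phiP => [|[|n]] // phi PC phit phiP _.
  pose f (a : 'M[F]_n.+2) := (invmx a *m phi a) ord0 ord_max.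
  split=> [|_].
    exists (fun a => t1n n.+2 (f a)) => a Ga; split; first exact: t1n_center.
    exact: almost_id_PC_fin.
  by exists f => a; apply: almost_id_PC_fin.
have phiE a : is_UTI a -> phi a = a.
  exact: (almost_id_PC_inf (PC_inf_preserves_comm PC) phit).
split=> //; exists (fun=> @oneI F) => a Ga; split; last by rewrite phiE // mulI1.
by split=> [|x Gx]; [exact: is_UTI1 | rewrite mul1I // mulI1].
Qed.
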